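(* Let $Q$ be an $m$-periodic quiver with $N$ nodes (so $1\le m\le N$), let $B_Q$ be the skew-symmetric $N\times N$ integer matrix representing $Q$, let $(B_Q,\mathbf{u})$ be the associated initial seed, and let $$\varphi=\sigma^m\circ\mu_m\circ\cdots\circ\mu_2\circ\mu_1:\ \mathbb{R}_+^N\longrightarrow\mathbb{R}_+^N$$ be the cluster iteration map of $Q$. If $\operatorname{rank}(B_Q)=2k<N$, then there exist i) a submersion $\pi:\mathbb{R}_+^N\longrightarrow\mathbb{R}_+^{2k}$, ii) a map $\hat\varphi:\mathbb{R}_+^{2k}\longrightarrow\mathbb{R}_+^{2k}$ such that $\pi\circ\varphi=\hat\varphi\circ\pi$. Furthermore, $\hat\varphi$ is symplectic with respect to the canonical log symplectic form $$\omega_0=\frac{dy_1}{y_1}\wedge\frac{dy_2}{y_2}+\cdots+\frac{dy_{2k-1}}{y_{2k-1}}\wedge\frac{dy_{2k}}{y_{2k}}$$ on $\mathbb{R}_+^{2k}$ (with coordinates $y_1,\ldots,y_{2k}$), that is, $\hat\varphi^*\omega_0=\omega_0$.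
   Context: $\mathbb{R}_+=(0,\infty)$; maps between manifolds are smooth. Quiver: an oriented graph with $N$ nodes labelled $1,\ldots,N$, with no loops and no 2-cycles (multiple arrows allowed). It is represented by the skew-symmetric integer matrix $B_Q=[b_{ij}]$, where $b_{ij}$ is the number of arrows from node $i$ to node $j$ minus the number of arrows from $j$ to $i$. Permutation: $\sigma$ denotes both the map $\sigma(u_1,u_2,\ldots,u_N)=(u_2,\ldots,u_N,u_1)$ and the $N\times N$ permutation matrix with entries $\sigma_{i,i+1}=1$ for $1\le i\le N-1$, $\sigma_{N,1}=1$, and all other entries $0$. Mutation of a matrix: for a skew-symmetric integer matrix $B=[b_{ij}]$ and $k\in\{1,\ldots,N\}$, $\mu_k(B)=[b'_{ij}]$ with $b'_{ij}=-b_{ij}$ if $i=k$ or $j=k$, and $b'_{ij}=b_{ij}+\frac12\left(|b_{ik}|b_{kj}+b_{ik}|b_{kj}|\right)$ otherwise. Mutation of a cluster: for a seed $(B,\mathbf{u})$ with $\mathbf{u}=(u_1,\ldots,u_N)$, $\mu_k(u_1,\ldots,u_N)=(u'_1,\ldots,u'_N)$ with $u'_i=u_i$ for $i\ne k$ and $$u'_k=\frac{\prod_{j:\,b_{kj}>0}u_j^{b_{kj}}+\prod_{j:\,b_{kj}<0}u_j^{-b_{kj}}}{u_k},$$ where empty products equal $1$. Mutations act on seeds, transforming matrix and cluster simultaneously. Hence in the composition $\mu_m\circ\cdots\circ\mu_1$ of cluster mutations started at $(B_Q,\mathbf{u})$, the cluster map $\mu_k$ is the one defined by the matrix $\mu_{k-1}\circ\cdots\circ\mu_1(B_Q)$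 (by $B_Q$ itself when $k=1$). Period: $Q$ has period $m$ (is $m$-periodic) if $m$ is the smallest positive integer such that $\mu_m\circ\cdots\circ\mu_1(B_Q)=\sigma^{-m}B_Q\,\sigma^m$. *)

(* Defs.v *)
From mathcomp Require Import all_boot all_order all_algebra.
From mathcomp Require Import boolp classical_sets reals topology normedtype derive.

Set Implicit Arguments.
Unset Strict Implicit.
Unset Printing Implicit Defensive.

Import GRing.Theory Num.Theory.
Import numFieldNormedType.Exports.

Local Open Scope ring_scope.
Local Open Scope classical_set_scope.

(* The nodes 1, ..., N are represented by the ordinals 0, ..., N.-1, and points
   of R^N by row vectors. *)

Record quiver (N : nat) : Type := Quiver {
  arrows : 'I_N -> 'I_N -> nat ;
  no_loop : forall i, arrows i i = 0%N ;
  no_2cycle : forall i j, arrows i j = 0%N \/ arrows j i = 0%N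
}.

Definition quiver_mx N (Q : quiver N) : 'M[int]_N :=
  \matrix_(i, j) ((arrows Q i j)%:Z - (arrows Q j i)%:Z).

(* [ordS i] is the cyclic successor of [i]: the entry in the last row is in the
   first column. *)
Definition sigma_mx (N : nat) : 'M[int]_N :=
  \matrix_(i, j) (j == ordS i)%:R.

Definition sigma (R : realType) N (u : 'rV[R]_N) : 'rV[R]_N :=
  \row_i u 0 (ordS i).

(* The division by 2 is exact: the dividend is 0 or +/- 2 |b_ik b_kj|. *)
Definition mutate_mx N (B : 'M[int]_N) (k : 'I_N) : 'M[int]_N :=
  \matrix_(i, j)
    if (i == k) || (j == k) then - B i j
    else B i j + ((`|B i k| * B k j + B i k * `|B k j|) %/ 2)%Z.

Definition mutate_cluster (R : realType) N (B : 'M[int]_N) (u : 'rV[R]_N)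
    (k : 'I_N) : 'rV[R]_N :=
  \row_i
    if i == k then
      (\prod_(j < N | 0 < B k j) u 0 j ^ B k j
       + \prod_(j < N | B k j < 0) u 0 j ^ (- B k j)) / u 0 k
    else u 0 i.

Definition seed (R : realType) (N : nat) : Type := ('M[int]_N * 'rV[R]_N)%type.

Definition mutate_seed (R : realType) N (s : seed R N) (k : 'I_N) : seed R N :=
  (mutate_mx s.1 k, mutate_cluster s.1 s.2 k).

Definition first_nodes (N m : nat) : seq 'I_N := take m (enum 'I_N).

(* [foldl] mutates at the head of the list first, so the next two definitions
   are mu_m o ... o mu_1 (for m <= N). *)
Definition mutate_mx_upto N (m : nat) (B : 'M[int]_N) : 'M[int]_N :=
  foldl (@mutate_mx N) B (first_nodes N m).

Definition mutate_seed_upto (R : realType) N (m : nat) (s : seed R N) :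
    seed R N :=
  foldl (@mutate_seed R N) s (first_nodes N m).

Definition period_eq N (Q : quiver N) (m : nat) : Prop :=
  mutate_mx_upto m (quiver_mx Q)
  = invmx (sigma_mx N ^+ m) *m quiver_mx Q *m sigma_mx N ^+ m.

(* mu_m only makes sense for a node m, whence m <= N. *)
Definition periodic N (Q : quiver N) (m : nat) : Prop :=
  [/\ (0 < m <= N)%N, period_eq Q m &
      forall l, (0 < l < m)%N -> ~ period_eq Q l].

Definition cluster_iteration_map (R : realType) N (Q : quiver N) (m : nat)
    (u : 'rV[R]_N) : 'rV[R]_N :=
  iter m (@sigma R N) (mutate_seed_upto m (quiver_mx Q, u)).2.

Definition orthant (R : realType) (n : nat) : set 'rV[R]_n :=
  [set u | forall i, 0 < u 0 i].

(* C^r regularity on an open set U of a function defined on the ambient space;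
   the values outside U are irrelevant. *)
Fixpoint class_C (R : realType) (n p r : nat) (U : set 'rV[R]_n)
    (f : 'rV[R]_n -> 'rV[R]_p) : Prop :=
  if r is r'.+1 then
    (forall x, U x -> differentiable f x) /\
    (forall v, class_C r' U (fun x => 'D_v f x))
  else forall x, U x -> {for x, continuous f}.

(* Smooth maps from R_+^n to R_+^p are represented by functions on R^n whose
   restriction to R_+^n is considered. *)
Definition smooth_map (R : realType) (n p : nat)
    (f : 'rV[R]_n -> 'rV[R]_p) : Prop :=
  (forall x, orthant x -> orthant (f x)) /\
  (forall r, class_C r (@orthant R n) f).

Definition submersion (R : realType) (n p : nat)
    (f : 'rV[R]_n -> 'rV[R]_p) : Prop :=
  smooth_map f /\
  (forall x, orthant x -> forall w, exists v, 'd f x v = w).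

Definition one_form (R : realType) (n : nat) : Type :=
  'rV[R]_n -> 'rV[R]_n -> R.

Definition two_form (R : realType) (n : nat) : Type :=
  'rV[R]_n -> 'rV[R]_n -> 'rV[R]_n -> R.

Definition dlog (R : realType) n (i : 'I_n) : one_form R n :=
  fun y v => v 0 i / y 0 i.

Definition wedge (R : realType) n (a b : one_form R n) : two_form R n :=
  fun y v w => a y v * b y w - a y w * b y v.

Definition pullback (R : realType) n p (f : 'rV[R]_n -> 'rV[R]_p)
    (omega : two_form R p) : two_form R n :=
  fun y v w => omega (f y) ('d f y v) ('d f y w).

Lemma fst_coord_subproof k (i : 'I_k) : (i.*2 < k.*2)%N.
Proof. by rewrite ltn_double. Qed.

Lemma snd_coord_subproof k (i : 'I_k) : (i.*2.+1 < k.*2)%N.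
Proof. by rewrite ltn_Sdouble. Qed.

(* With i counted from 0, the coordinates y_{2i+1} and y_{2i+2} (counted
   from 1). *)
Definition fst_coord k (i : 'I_k) : 'I_k.*2 := Ordinal (fst_coord_subproof i).
Definition snd_coord k (i : 'I_k) : 'I_k.*2 := Ordinal (snd_coord_subproof i).

Definition log_symplectic_form (R : realType) (k : nat) : two_form R k.*2 :=
  fun y v w =>
    \sum_(i < k) wedge (@dlog R _ (fst_coord i)) (@dlog R _ (snd_coord i)) y v w.

Definition log_symplectic_map (R : realType) (k : nat)
    (f : 'rV[R]_k.*2 -> 'rV[R]_k.*2) : Prop :=
  forall y, orthant y -> forall v w,
    pullback f (@log_symplectic_form R k) y v w = log_symplectic_form y v w.

(* Main.v *)
Require Import Defs.
From mathcomp Require Import all_boot all_order all_algebra.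
From mathcomp Require Import boolp classical_sets reals topology normedtype.
From mathcomp Require Import derive functions landau interval_inference.
From mathcomp Require Import sequences exp.
From mathcomp Require Import ring zify.

Set Implicit Arguments.
Unset Strict Implicit.
Unset Printing Implicit Defensive.

Import Order.TTheory GRing.Theory Num.Theory.
Import numFieldNormedType.Exports.

Local Open Scope ring_scope.
Local Open Scope classical_set_scope.

(** The cluster map [phi] preserves the closed two-form with constant
    coefficients [B_Q] in the logarithmic coordinates [x = log u], and the
    theorem is the reduction of [phi] by the kernel of that form.

    In logarithmic coordinates the mutation at [k] of a seed with matrix [B] is
    the shear [x |-> x - log (1 + exp (x B)_k) e_k] followed by an integer
    linear involution [E], a branch of the tropical mutation ([log_mutationE]).
    Two facts follow. The shear moves along the Hamiltonian direction of the
    linear function [x |-> (x B)_k], hence preserves the form [B]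
    ([bform_shear]), and [E] carries [B] to the mutated matrix, [E B' E^T = B]
    ([tropical_mutation]). Moreover [x B] determines [x' B'], since both factors
    have this property. Both facts pass to compositions, which is why
    [presymplectic_map] records them together with smoothness. The power
    [sigma^m] is orthogonal, and the period condition says precisely that it
    carries the form of the last seed back to [B_Q]; so [phi], read in
    logarithmic coordinates, is a presymplectic map [F] from [B_Q] to itself
    ([cluster_map_row_exp]).

    Over the reals, [B_Q = W J W^T] with [J] the canonical symplectic matrix of
    size [2k] and [W] of full column rank, so that [S W = 1] for some [S]
    ([symplectic_factor]), and [x B_Q] and [x W] determine each other.  The
    submersion is [x |-> x W] and the reduced map is [y |-> F (y S) W], both
    read through the chart [exp].  Since [x] and [x W S] have the same image
    under [W], so do [F x] and [F (x W S)], which is the semiconjugacy; and the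
    differential of the reduced map preserves [J] because that of [F] preserves
    [W J W^T].

    All maps in sight are built from coordinates and constants by sums,
    products, [exp] and [log] of positive functions.  This class is closed under
    substitution and under directional derivatives, whence smoothness
    ([elementary_class_C]). *)

(** * Differential calculus of row-vector valued maps *)

Lemma near_eq_differentiable (R : realType) (V W : normedModType R)
    (f g : V -> W) (x : V) :
  (\near x, f x = g x) -> differentiable f x -> differentiable g x.
Proof.
move=> fg df; have [dfc dfE] := (diff_locallyP x f).1 df.
have fgx : f x = g x by apply: nbhs_singleton fg.
suff dgE : g \o shift x = cst (g x) + 'd f x +o_ 0 id.
  apply/diff_locallyP; have -> : 'd g x = 'd f x :> (V -> W).
    exact: diff_unique.
  by [].
apply/eqaddoP => _/posnumP[e].
have /eqaddoP/(_ e%:num) := dfE; move=> /(_ [gt0 of e%:num]).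
apply: filter_app; move: fg; rewrite (near_shift 0) subr0.
apply: filter_app; near=> h => /= fgh.
by rewrite -![(_ + _ : _ -> _) _]/(_ + _) /cst /= fgh fgx.
Unshelve. all: by end_near. Qed.

Lemma differentiable_row (R : realType) n p (F : 'rV[R]_n -> 'rV[R]_p) x :
  (forall i, differentiable (fun y => F y 0 i) x) -> differentiable F x.
Proof.
move=> dF.
have -> : F = \sum_(i < p) (fun y => F y 0 i *: delta_mx 0 i).
  by apply/funext => y; rewrite fct_sumE -row_sum_delta.
by apply: differentiable_sum => i; apply: differentiableZl.
Qed.

Lemma derive_row (R : realType) n p (F : 'rV[R]_n -> 'rV[R]_p) x v i :
  differentiable F x -> 'D_v F x 0 i = 'D_v (fun y => F y 0 i) x.
Proof. by move=> dF; rewrite derive_mx ?mxE//; exact: diff_derivable. Qed.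

Lemma derive_coord (R : realType) n (x v : 'rV[R]_n) i :
  'D_v (fun y : 'rV[R]_n => y 0 i) x = v 0 i.
Proof. by rewrite -(@derive_row _ _ _ (@idfun 'rV[R]_n))// derive_id. Qed.

Lemma differentiable_comp1 (R : realType) n (h : R -> R)
    (f : 'rV[R]_n -> R) x c :
  is_derive (f x) 1 h c -> differentiable f x ->
  differentiable (h \o f) x /\ forall v, 'D_v (h \o f) x = c * 'D_v f x.
Proof.
move=> [dh hc] df.
have dh' : differentiable h (f x) by apply/derivable1_diffP.
have dhf : differentiable (h \o f) x by exact: differentiable_comp.
split=> // v; rewrite !deriveE// diff_comp//= diff1E//=.
by rewrite derive1E hc /GRing.scale/= mulrC.
Qed.

Lemma diff_compE (R : realType) n p q (f : 'rV[R]_n -> 'rV[R]_p)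
    (g : 'rV[R]_p -> 'rV[R]_q) x v :
  differentiable f x -> differentiable g (f x) ->
  'd (g \o f) x v = 'd g (f x) ('d f x v).
Proof. by move=> df dg; rewrite (diff_comp df dg). Qed.

(** Openness of [U] makes agreement on [U] agreement near each point, which is
    what derivatives see. *)
Lemma eq_class_C (R : realType) n p r (U : set 'rV[R]_n)
    (F G : 'rV[R]_n -> 'rV[R]_p) :
  open U -> (forall x, U x -> F x = G x) -> class_C r U F -> class_C r U G.
Proof.
move=> oU FG.
have nFG (F' G' : 'rV[R]_n -> 'rV[R]_p) x : (forall x, U x -> F' x = G' x) ->
    U x -> \near x, F' x = G' x.
  move=> FG' Ux.
  exact: (@filterS _ _ (nbhs_filter x) U _ FG' (open_nbhs_nbhs (conj oU Ux))).
elim: r F G FG => [|r IHr] F G FG.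
  move=> cF x Ux; have := cF x Ux.
  rewrite /prop_for /continuous_at -FG//; apply: cvg_trans.
  apply: (@near_eq_cvg _ _ _ (nbhs_filter x)).
  exact: nFG FG Ux.
move=> [dF cF]; split=> [x Ux|v].
  exact: near_eq_differentiable (nFG _ _ _ FG Ux) (dF x Ux).
apply: IHr (cF v) => x Ux; exact: near_eq_derive (nFG _ _ _ FG Ux).
Qed.

Lemma open_orthant (R : realType) n : open (@orthant R n).
Proof.
rewrite openE => x x_gt0.
have coord_gt0 i : \forall u \near x, 0 < (u : 'rV[R]_n) 0 i.
  exact: (@coord_continuous R 1 n 0 i x _ (lt_nbhsr (x_gt0 i))).
exact: (@filter_forall _ _ _ _ (nbhs_filter x) coord_gt0).
Qed.

(** * Elementary functions are smooth *)

(** The positivity hypothesis on the arguments of [ln] makes the class stable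
    under derivation, and holds on [U] only: the logarithmic chart of the
    orthant belongs to it although [ln] is degenerate outside. *)
Inductive elementary (R : realType) n (U : set 'rV[R]_n) :
    ('rV[R]_n -> R) -> Prop :=
| elementary_coord i : elementary U (fun x => x 0 i)
| elementary_cst c : elementary U (fun=> c)
| elementaryD f g :
    elementary U f -> elementary U g -> elementary U (fun x => f x + g x)
| elementaryM f g :
    elementary U f -> elementary U g -> elementary U (fun x => f x * g x)
| elementary_expR f : elementary U f -> elementary U (fun x => expR (f x))
| elementary_ln f : elementary U f -> (forall x, U x -> 0 < f x) ->
    elementary U (fun x => ln (f x)).

Definition elementary_map (R : realType) n p (U : set 'rV[R]_n)
    (F : 'rV[R]_n -> 'rV[R]_p) : Prop :=
  forall i, elementary U (fun x => F x 0 i).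

Lemma elementary_comp (R : realType) n p (U : set 'rV[R]_n)
    (V : set 'rV[R]_p) (F : 'rV[R]_n -> 'rV[R]_p) f :
  elementary_map U F -> (forall x, U x -> V (F x)) ->
  elementary V f -> elementary U (f \o F).
Proof.
move=> eF UV.
elim=> {f} [i|c|f g _ IHf _ IHg|f g _ IHf _ IHg|f _ IHf|f _ IHf f0].
- exact: eF.
- exact: elementary_cst.
- exact: (elementaryD IHf IHg).
- exact: (elementaryM IHf IHg).
- exact: (elementary_expR IHf).
- by apply: (elementary_ln IHf) => x Ux; apply/f0/UV.
Qed.

Lemma elementary_map_comp (R : realType) n p q (U : set 'rV[R]_n)
    (V : set 'rV[R]_p) (F : 'rV[R]_n -> 'rV[R]_p) (G : 'rV[R]_p -> 'rV[R]_q) :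
  elementary_map U F -> (forall x, U x -> V (F x)) -> elementary_map V G ->
  elementary_map U (G \o F).
Proof. by move=> eF UV eG i; exact: elementary_comp eF UV (eG i). Qed.

Lemma elementary_sum (R : realType) n (U : set 'rV[R]_n) (I : Type)
    (r : seq I) (P : pred I) (f : I -> 'rV[R]_n -> R) :
  (forall i, elementary U (f i)) ->
  elementary U (fun x => \sum_(i <- r | P i) f i x).
Proof.
move=> ef; elim: r => [|i r IHr].
  by under eq_fun do rewrite big_nil; exact: elementary_cst.
by under eq_fun do rewrite big_cons; case: (P i) => //; exact: elementaryD.
Qed.

Lemma elementary_map_mulmx (R : realType) n p (U : set 'rV[R]_n)
    (A : 'M[R]_(n, p)) : elementary_map U (fun x => x *m A).
Proof.
move=> i; under eq_fun do rewrite mxE.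
apply: elementary_sum => j; apply: elementaryM; first exact: elementary_coord.
exact: elementary_cst.
Qed.

(** Equality of the derivative with [g] is claimed on [U] alone, since outside
    [U] a logarithm in [f] need not even be differentiable. *)
Lemma elementary_derive (R : realType) n (U : set 'rV[R]_n) f :
  elementary U f ->
  (forall x, U x -> differentiable f x) /\
  forall v, exists2 g, elementary U g & forall x, U x -> 'D_v f x = g x.
Proof.
have chain h c x (F : 'rV[R]_n -> R) := @differentiable_comp1 R n h F x c.
elim=> {f} [i|c|f g ef [df Df] eg [dg Dg]|f g ef [df Df] eg [dg Dg]|
            f ef [df Df]|f ef [df Df] f0].
- split=> [x _|v]; first exact: differentiable_coord.
  exists (fun=> v 0 i); first exact: elementary_cst.
  by move=> x _; exact: derive_coord.
- split=> [x _|v]; first exact: differentiable_cst.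
  exists (fun=> 0); first exact: elementary_cst.
  by move=> x _; rewrite derive_cst.
- split=> [x Ux|v]; first exact: differentiableD (df x Ux) (dg x Ux).
  have [f' ef' f'E] := Df v; have [g' eg' g'E] := Dg v.
  exists (fun x => f' x + g' x); first exact: elementaryD.
  move=> x Ux; rewrite -f'E// -g'E//.
  by rewrite -deriveD//; apply: diff_derivable; [exact: df|exact: dg].
- split=> [x Ux|v]; first exact: differentiableM (df x Ux) (dg x Ux).
  have [f' ef' f'E] := Df v; have [g' eg' g'E] := Dg v.
  exists (fun x => f x * g' x + g x * f' x).
    by apply: elementaryD; exact: elementaryM.
  move=> x Ux; rewrite -f'E// -g'E//.
  by rewrite -deriveM//; apply: diff_derivable; [exact: df|exact: dg].
- split=> [x Ux|v].
    by have [] := chain _ _ x f (is_derive_expR (f x)) (df x Ux).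
  have [f' ef' f'E] := Df v.
  exists (fun x => expR (f x) * f' x).
    by apply: elementaryM => //; exact: elementary_expR.
  move=> x Ux; rewrite -f'E//.
  by have [_ ->] := chain _ _ x f (is_derive_expR (f x)) (df x Ux).
- split=> [x Ux|v].
    by have [] := chain _ _ x f (is_derive1_ln (f0 x Ux)) (df x Ux).
  have [f' ef' f'E] := Df v.
  (* the reciprocal of f, written inside the class as exp (- ln f) *)
  exists (fun x => expR (-1 * ln (f x)) * f' x).
    apply: elementaryM => //; apply/elementary_expR/elementaryM.
      exact: elementary_cst.
    exact: elementary_ln.
  move=> x Ux; rewrite -f'E// mulN1r expRN lnK ?posrE ?f0//.
  by have [_ ->] := chain _ _ x f (is_derive1_ln (f0 x Ux)) (df x Ux).
Qed.

Lemma elementary_map_differentiable (R : realType) n p (U : set 'rV[R]_n)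
    (F : 'rV[R]_n -> 'rV[R]_p) x :
  elementary_map U F -> U x -> differentiable F x.
Proof.
move=> eF Ux; apply: differentiable_row => i.
by have [dF _] := elementary_derive (eF i); exact: dF.
Qed.

(** Differentiate repeatedly: the directional derivatives stay in the class, and
    [eq_class_C] replaces each of them by its elementary expression on [U]. *)
Lemma elementary_class_C (R : realType) n p r (U : set 'rV[R]_n)
    (F : 'rV[R]_n -> 'rV[R]_p) :
  open U -> elementary_map U F -> class_C r U F.
Proof.
move=> oU; elim: r F => [|r IHr] F eF /=.
  move=> x Ux; apply: differentiable_continuous.
  exact: elementary_map_differentiable eF Ux.
split=> [x Ux|v]; first exact: elementary_map_differentiable eF Ux.
have /choice[g gP] : forall i, exists g : 'rV[R]_n -> R, elementary U g /\
    forall x, U x -> 'D_v (fun y => F y 0 i) x = g x.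
  by move=> i; have [_ /(_ v)[g eg gE]] := elementary_derive (eF i); exists g.
apply: (@eq_class_C _ _ _ _ _ (fun x => \row_i g i x)) => //.
  move=> x Ux; apply/rowP => i; rewrite mxE derive_row ?(gP i).2//.
  exact: elementary_map_differentiable eF Ux.
apply: IHr => i; under eq_fun do rewrite mxE; exact: (gP i).1.
Qed.

Lemma elementary_ln1expR (R : realType) n (U : set 'rV[R]_n) f :
  elementary U f -> elementary U (fun x => ln (1 + expR (f x))).
Proof.
move=> ef; apply: elementary_ln => [|z _]; last by rewrite addr_gt0// expR_gt0.
exact: (elementaryD (elementary_cst _ 1) (elementary_expR ef)).
Qed.

Lemma derivable_ln1expR (R : realType) (t : R) :
  derivable (fun t => ln (1 + expR t)) t 1.
Proof.
apply/derivable1_diffP.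
apply: (@differentiable_comp _ _ _ _ (fun t => 1 + expR t) (@ln R)).
  have dexp : differentiable (@expR R) t.
    exact/derivable1_diffP/derivable_expR.
  exact: (differentiableD (differentiable_cst (1 : R) t) dexp).
apply/derivable1_diffP; apply: (@ex_derive _ _ _ _ _ _ (1 + expR t)^-1).
by apply: is_derive1_ln; rewrite addr_gt0// expR_gt0.
Qed.

Lemma differentiable_mulmx (R : realType) n p (E : 'M[R]_(n, p)) x :
  differentiable (fun x : 'rV[R]_n => x *m E) x.
Proof.
exact: elementary_map_differentiable (elementary_map_mulmx setT E) I.
Qed.

Lemma diff_mulmx (R : realType) n p (E : 'M[R]_(n, p)) x v :
  'd (fun x : 'rV[R]_n => x *m E) x v = v *m E.
Proof.
have -> : 'd (mulmxr E : 'rV_n -> 'rV_p) x = mulmxr E :> ('rV_n -> 'rV_p);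
  last by [].
apply: diff_lin => y; apply: differentiable_continuous.
exact: differentiable_mulmx.
Qed.

Lemma diff_shear (R : realType) n (g : 'rV[R]_n -> R) (d x u : 'rV[R]_n) :
  differentiable g x ->
  'd (fun y => y - g y *: d) x u = u - 'D_u g x *: d.
Proof.
move=> dg.
have -> : (fun y => y - g y *: d) = idfun - (fun y => g y *: d) by [].
rewrite diffB; [|exact: ex_diff|exact: differentiableZl].
have id_diff : 'd (@idfun 'rV[R]_n) x u = u.
  by rewrite (@diff_val _ _ _ _ _ _ _ (is_diff_id _)).
have dl : 'd (fun y => g y *: d) x u = 'd g x u *: d.
  by have /(congr1 (fun F => F u)) := diffZl d dg.
rewrite deriveE//.
exact: (congr2 (fun a b => a - b) id_diff dl).
Qed.

(** * Normal form of skew-symmetric matrices *)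

Definition bform (F : fieldType) n (A : 'M[F]_n) (v w : 'rV[F]_n) : F :=
  (v *m A *m w^T) 0 0.

(** The canonical symplectic form on row vectors of even size, in the
    coordinates that the logarithmic chart gives to [log_symplectic_form]. *)
Definition symp (F : fieldType) k (a b : 'rV[F]_k.*2) : F :=
  \sum_(i < k) (a 0 (fst_coord i) * b 0 (snd_coord i)
                - b 0 (fst_coord i) * a 0 (snd_coord i)).

Lemma skewE (V : zmodType) n (A : 'M[V]_n) i j : A^T = - A -> A j i = - A i j.
Proof. by move=> /matrixP/(_ i j); rewrite !mxE. Qed.

Lemma skew_diag (D : numDomainType) n (A : 'M[D]_n) i : A^T = - A -> A i i = 0.
Proof.
move=> /(skewE i i)/eqP.
by rewrite -addr_eq0 -mulr2n mulrn_eq0 => /eqP.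
Qed.

(** One step of the symplectic Gram-Schmidt process. The subtracted term makes
    rows and columns [i] and [j] vanish, so the row space of what remains meets
    the plane of those two rows trivially: on that plane a vector is determined
    by its entries [i] and [j], because [A i i = A j j = 0] and [A i j != 0]. *)
Lemma rank_split_plane (F : realFieldType) n (A : 'M[F]_n) i j :
  A^T = - A -> A i j != 0 ->
  (\rank (A - (A i j)^-1 *: ((row i A)^T *m row j A
                             - (row j A)^T *m row i A))%R + 2 <= \rank A)%N.
Proof.
move=> Askew a0; set A' := A - _; set a := A i j in a0 *.
have Aji : A j i = - a by exact: skewE.
have Aii := skew_diag i Askew; have Ajj := skew_diag j Askew.
pose C := col_mx (row i A) (row j A).
have C_inj (c : 'rV_(1 + 1)) :
    (c *m C) 0 i = 0 -> (c *m C) 0 j = 0 -> c = 0.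
  rewrite -[c]hsubmxK mul_row_col !mxE !big_ord1 !mxE Aii Ajj Aji -/a.
  rewrite !mulr0 add0r addr0 mulrN => /eqP; rewrite oppr_eq0 mulf_eq0.
  rewrite (negPf a0) orbF => /eqP c1 /eqP; rewrite mulf_eq0 (negPf a0) orbF.
  move=> /eqP c0; apply/rowP => l; rewrite [RHS]mxE mxE.
  by case: split_ordP => l' _; rewrite !ord1 !mxE ?c0 ?c1.
have A'i l : A' l i = 0.
  rewrite !mxE !big_ord1 !mxE Aii Aji -/a (skewE i l)//.
  by field.
have A'j l : A' l j = 0.
  rewrite !mxE !big_ord1 !mxE Ajj -/a (skewE j l)//.
  by field.
have rankC : \rank C = 2%N.
  apply/eqP/inj_row_free => c cC; apply: C_inj; by rewrite cC mxE.
have A'C : (A' :&: C)%MS = 0.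
  apply/eqP; rewrite -submx0; apply/rV_subP => u.
  rewrite sub_capmx => /andP[/submxP[z uz] /submxP[c uc]].
  have -> : u = 0; last exact: sub0mx.
  rewrite uc (C_inj c) ?mul0mx// -uc uz mxE.
    by rewrite big1// => l _; rewrite A'i mulr0.
  by rewrite big1// => l _; rewrite A'j mulr0.
rewrite -rankC -mxrank_disjoint_sum//; apply: mxrankS.
rewrite addsmx_sub col_mx_sub !row_sub !andbT.
rewrite /A' addmx_sub// -scaleNr scalemx_sub// addmx_sub//.
  by rewrite mulmx_sub ?row_sub.
by rewrite -mulNmx mulmx_sub ?row_sub.
Qed.

(** Iterating [rank_split_plane] exhausts [A] in [k] steps, as the rank drops by
    two each time. An inequality on the rank keeps the induction free of parity
    considerations. *)
Lemma skew_sum_planes (F : realFieldType) n k (A : 'M[F]_n) :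
  A^T = - A -> (\rank A <= k.*2)%N ->
  exists p q : nat -> 'rV[F]_n,
    A = \sum_(i < k) ((p i)^T *m q i - (q i)^T *m p i).
Proof.
elim: k A => [|k IHk] A Askew rA.
  exists (fun=> 0), (fun=> 0); rewrite big_ord0.
  by apply/eqP; rewrite -mxrank_eq0 -leqn0.
have [->|/matrix0Pn[i [j a0]]] := eqVneq A 0.
  exists (fun=> 0), (fun=> 0); rewrite big1// => i _.
  by rewrite mulmx0 subr0.
have rA' := leq_trans (rank_split_plane Askew a0) rA.
set a := A i j in a0 rA'; set A' := A - _ in rA'.
have A'skew : A'^T = - A'.
  apply/matrixP => s t; rewrite !mxE !big_ord1 !mxE (skewE s t Askew).
  by ring.
have [|p [q A'E]] := IHk A' A'skew.
  by move: rA'; rewrite addn2 doubleS.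
exists (fun l => if l is l'.+1 then p l' else a^-1 *: row i A).
exists (fun l => if l is l'.+1 then q l' else row j A).
rewrite big_ord_recl/= -A'E; apply/matrixP => s t.
by rewrite !mxE !big_ord1 !mxE; ring.
Qed.

Lemma half_coord k (c : 'I_k.*2) :
  exists i : 'I_k, c = fst_coord i \/ c = snd_coord i.
Proof.
have lt_ck : (c./2 < k)%N by rewrite ltn_half_double.
exists (Ordinal lt_ck); have := odd_double_half c.
by case: (odd c) => /= cE; [right|left]; apply: val_inj; rewrite /= -[LHS]cE.
Qed.

Lemma coord_eqE k (i j : 'I_k) :
  ((fst_coord i == fst_coord j) = (i == j)) *
  ((snd_coord i == snd_coord j) = (i == j)) *
  ((fst_coord i == snd_coord j) = false) *
  ((snd_coord i == fst_coord j) = false).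
Proof. by rewrite -!val_eqE/=; do !split; lia. Qed.

Lemma symp_nondegenerate (F : fieldType) k (a : 'rV[F]_k.*2) :
  (forall b, symp a b = 0) -> a = 0.
Proof.
move=> a0; apply/rowP => c; rewrite mxE.
have [i [->|->]] := half_coord c.
- have := a0 (delta_mx 0 (snd_coord i)); rewrite /symp (bigD1 i)//= big1.
    by rewrite !mxE !coord_eqE !eqxx /= mulr1 mul0r subr0 addr0.
  by move=> l /negPf li; rewrite !mxE !coord_eqE li mulr0 mul0r subr0.
- have := a0 (delta_mx 0 (fst_coord i)); rewrite /symp (bigD1 i)//= big1.
    rewrite !mxE !coord_eqE !eqxx /= mul1r mulr0 sub0r addr0 => /eqP.
    by rewrite oppr_eq0 => /eqP.
  by move=> l /negPf li; rewrite !mxE !coord_eqE li mulr0 mul0r subr0.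
Qed.

Lemma bform_nondegenerate (F : fieldType) n (A : 'M[F]_n) z :
  (forall w, bform A z w = 0) -> z *m A = 0.
Proof.
move=> zA; apply/rowP => i; have := zA (delta_mx 0 i).
by rewrite /bform trmx_delta -colE !mxE.
Qed.

(** The Darboux normal form of a skew matrix. The columns of [W] are the vectors
    of [skew_sum_planes], interleaved; the row space of [A] lies in that of
    [W^T], so the rank hypothesis forces [W] to have full column rank, and
    nondegeneracy of the symplectic form identifies the kernels. *)
Lemma symplectic_factor (F : realFieldType) n k (A : 'M[F]_n) :
  A^T = - A -> \rank A = k.*2 ->
  exists (W : 'M[F]_(n, k.*2)) (S : 'M[F]_(k.*2, n)),
    [/\ S *m W = 1%:M,
        forall v w, bform A v w = symp (v *m W) (w *m W)
      & forall z : 'rV_n, z *m A = 0 <-> z *m W = 0].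
Proof.
move=> Askew rA; have [|p [q AE]] := @skew_sum_planes F n k A Askew.
  by rewrite rA.
pose W : 'M[F]_(n, k.*2) :=
  \matrix_(l, c) (if odd c then q c./2 else p c./2) 0 l.
have W_fst (v : 'rV_n) (i : 'I_k) :
    (v *m W) 0 (fst_coord i) = (v *m (p i)^T) 0 0.
  by rewrite !mxE; apply: eq_bigr => l _; rewrite !mxE/= odd_double doubleK.
have W_snd (v : 'rV_n) (i : 'I_k) :
    (v *m W) 0 (snd_coord i) = (v *m (q i)^T) 0 0.
  rewrite !mxE; apply: eq_bigr => l _.
  by rewrite !mxE/= odd_double uphalf_double.
have rank1E (r s v w : 'rV[F]_n) :
    (v *m (r^T *m s) *m w^T) 0 0 = (v *m r^T) 0 0 * (w *m s^T) 0 0.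
  rewrite mulmxA -mulmxA mxE big_ord1; congr (_ * _).
  by rewrite !mxE; apply: eq_bigr => l _; rewrite !mxE ord1 mulrC.
have formE v w : bform A v w = symp (v *m W) (w *m W).
  rewrite /bform AE mulmx_sumr mulmx_suml summxE; apply: eq_bigr => i _.
  rewrite !W_fst !W_snd mulmxBr mulmxBl mxE [X in _ + X]mxE !rank1E.
  by rewrite [X in _ - X]mulrC.
have A_sub_WT : (A <= W^T)%MS.
  rewrite AE; apply: summx_sub => i _.
  have p_sub : (p i <= W^T)%MS.
    rewrite (_ : p i = row (fst_coord i) W^T) ?row_sub//.
    by apply/rowP => l; rewrite !mxE/= odd_double doubleK.
  have q_sub : (q i <= W^T)%MS.
    rewrite (_ : q i = row (snd_coord i) W^T) ?row_sub//.
    by apply/rowP => l; rewrite !mxE/= odd_double uphalf_double.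
  by rewrite addmx_sub -?mulNmx ?mulmx_sub.
have W_full : row_full W.
  apply/eqP/anti_leq; rewrite rank_leq_col/= -(mxrank_tr W).
  by have := mxrankS A_sub_WT; rewrite rA.
exists W, (pinvmx W); split=> // [|z]; first exact: mulVpmx.
split=> [zA|zW].
  apply: symp_nondegenerate => b.
  have <- : b *m pinvmx W *m W = b by rewrite -mulmxA mulVpmx// mulmx1.
  by rewrite -formE /bform zA mul0mx mxE.
apply: bform_nondegenerate => w; rewrite formE zW /symp big1// => i _.
by rewrite !mxE mul0r mulr0 subr0.
Qed.

(** * Presymplectic maps *)

(** The second condition says that [F] descends to the quotients by the kernels
    of the two forms. Being immediate for each generator and stable under
    composition, it gives the reduction without integrating the third condition
    along the kernel. *)
Definition presymplectic_map (R : realType) N (A A' : 'M[R]_N)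
    (F : 'rV[R]_N -> 'rV[R]_N) : Prop :=
  [/\ elementary_map setT F,
      forall x y, x *m A = y *m A -> F x *m A' = F y *m A'
    & forall x v w, bform A' ('d F x v) ('d F x w) = bform A v w].

Lemma presymplectic_comp (R : realType) N (A A' A'' : 'M[R]_N) F G :
  presymplectic_map A A' F -> presymplectic_map A' A'' G ->
  presymplectic_map A A'' (G \o F).
Proof.
move=> [eF AF dF] [eG AG dG]; split=> [|x y xy|x v w].
- exact: elementary_map_comp eF _ eG.
- exact/AG/AF.
- rewrite diff_comp ?dG ?dF//; exact: elementary_map_differentiable.
Qed.

Lemma presymplectic_mulmx (R : realType) N (A A' E : 'M[R]_N) :
  E \in unitmx -> E *m A' *m E^T = A ->
  presymplectic_map A A' (fun x => x *m E).
Proof.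
move=> uE EA; split=> [|x y xy|x v w].
- exact: elementary_map_mulmx.
- have EA' (z : 'rV_N) : z *m E *m A' = z *m A *m invmx E^T.
    by rewrite -EA !mulmxA mulmxK// unitmx_tr.
  by rewrite !EA' xy.
- by rewrite !diff_mulmx /bform -EA trmx_mul !mulmxA.
Qed.

(** A transvection along [e_k] preserves the form, for any coefficient [c]: the
    two linear terms cancel by skew-symmetry and the quadratic one vanishes
    because [A k k = 0]. *)
Lemma bform_shear (R : realType) N (A : 'M[R]_N) k (c : R) v w :
  A^T = - A ->
  bform A (v - (c * (v *m A) 0 k) *: delta_mx 0 k)
          (w - (c * (w *m A) 0 k) *: delta_mx 0 k) = bform A v w.
Proof.
move=> Askew.
set d : 'rV[R]_N := delta_mx 0 k.
have fE (u : 'rV[R]_N) : (u *m A *m d^T) 0 0 = (u *m A) 0 k.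
  by rewrite trmx_delta -colE mxE.
have dA (u : 'rV[R]_N) : (d *m A *m u^T) 0 0 = - (u *m A) 0 k.
  have tr1 (X : 'M[R]_1) : X^T = X.
    by apply/matrixP => i j; rewrite mxE !ord1.
  rewrite -fE -[d *m A *m u^T]tr1 !trmx_mul !trmxK Askew.
  by rewrite mulNmx mulmxN mxE mulmxA.
have dd : (d *m A *m d^T) 0 0 = 0.
  by rewrite fE -rowE mxE skew_diag.
have sub00 (X Y : 'M[R]_1) : (X - Y) 0 0 = X 0 0 - Y 0 0 by rewrite !mxE.
have scale00 a (X : 'M[R]_1) : (a *: X) 0 0 = a * X 0 0 by rewrite mxE.
rewrite /bform; set a := c * _; set b := c * _.
have -> : (w - b *: d)^T = w^T - b *: d^T.
  by apply/matrixP=> i j; rewrite !mxE.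
rewrite !mulmxBl !mulmxBr -!scalemxAl -!scalemxAr !(sub00, scale00).
by rewrite dd fE dA /a /b; ring.
Qed.

(** The shear depends on [x] through [x A] alone, and its differential is the
    transvection of [bform_shear], where [c] is the derivative of [h]. *)
Lemma presymplectic_transvection (R : realType) N (A : 'M[R]_N) k (h : R -> R) :
  A^T = - A -> (forall t, derivable h t 1) ->
  elementary setT (fun x => h ((x *m A) 0 k)) ->
  presymplectic_map A A (fun x => x - h ((x *m A) 0 k) *: delta_mx 0 k).
Proof.
move=> Askew dh eh; split=> [i|x y xy|x v w].
- have -> : (fun x : 'rV[R]_N => (x - h ((x *m A) 0 k) *: delta_mx 0 k) 0 i) =
      (fun x => x 0 i
        + -1 * (h ((x *m A) 0 k) * (delta_mx 0 k : 'rV[R]_N) 0 i)).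
    by apply/funext => x; rewrite mxE [X in _ + X]mxE [X in - X]mxE mulN1r.
  apply: elementaryD; first exact: elementary_coord.
  apply: elementaryM; first exact: elementary_cst.
  by apply: elementaryM => //; exact: elementary_cst.
- by rewrite !mulmxBl xy.
- pose f (x : 'rV[R]_N) := (x *m A) 0 k.
  have dA := differentiable_mulmx A x.
  have df : differentiable f x.
    by have [/(_ x I)] := elementary_derive (elementary_map_mulmx setT A k).
  have Df u : 'D_u f x = f u by rewrite -derive_row// deriveE// diff_mulmx.
  have dhx : is_derive (f x) 1 h ('D_1 h (f x)) by exact: DeriveDef.
  have [dhf Dhf] := differentiable_comp1 dhx df.
  by rewrite !(diff_shear _ _ dhf) !Dhf !Df bform_shear.
Qed.

(** * Matrix mutation as a congruence *)

(** The entry [-2] turns the coefficient of [x_k] from [1] into [-1]. *)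
Definition tropical_col N (B : 'M[int]_N) (k : 'I_N) : 'cV[int]_N :=
  \col_j (if j == k then -2 else if 0 < B k j then B k j else 0).

(** In row vectors, the map sending [x_k] to [- x_k + sum_j max (B_kj, 0) x_j]:
    the mutation with the second monomial of the exchange relation dropped,
    which is one linear branch of the tropical mutation. *)
Definition tropical_mx N (B : 'M[int]_N) (k : 'I_N) : 'M[int]_N :=
  1%:M + tropical_col B k *m delta_mx 0 k.

Lemma tropical_mx_invol N (B : 'M[int]_N) k :
  tropical_mx B k *m tropical_mx B k = 1%:M.
Proof.
rewrite /tropical_mx mulmxDl mul1mx mulmxDr mulmx1.
set c := tropical_col B k; set d : 'rV_N := delta_mx 0 k.
have -> : c *m d *m (c *m d) = (-2) *: (c *m d).
  rewrite mulmxA -[c *m d *m c]mulmxA -rowE.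
  have -> : row k c = (-2)%:M.
    by apply/matrixP => i j; rewrite !ord1 !mxE eqxx.
  by rewrite mul_mx_scalar -scalemxAl.
by rewrite -addrA -[X in X + (X + _)]scale1r -!scalerDl scale0r addr0.
Qed.

(** In each of the four sign cases the dividend is [0] or twice a product. *)
Lemma half_tropical (a c : int) :
  ((`|a| * c + a * `|c|) %/ 2)%Z =
  (if a < 0 then - a else 0) * c + a * (if 0 < c then c else 0).
Proof.
have [a0|a0] := ltrP a 0; have [c0|c0] := ltrP 0 c.
- by rewrite ltr0_norm// gtr0_norm// mulNr addNr div0z; ring.
- rewrite ltr0_norm// ler0_norm//.
  have -> : - a * c + a * - c = (- a * c) * 2 by ring.
  by rewrite mulzK//; ring.
- rewrite ger0_norm// gtr0_norm//.
  have -> : a * c + a * c = (a * c) * 2 by ring.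
  by rewrite mulzK//; ring.
- by rewrite ger0_norm// ler0_norm// mulrN subrr div0z; ring.
Qed.

(** Matrix mutation is a congruence: off row and column [k], the correction term
    of [mutate_mx] is what the positive parts in [tropical_mx]
    contribute, by [half_tropical]. *)
Lemma tropical_mutation N (B : 'M[int]_N) k :
  B^T = - B ->
  tropical_mx B k *m mutate_mx B k *m (tropical_mx B k)^T = B.
Proof.
move=> Bskew; set c := tropical_col B k.
have Bkk : B k k = 0 by exact: skew_diag.
have E_mul (M : 'M[int]_N) i j :
    (tropical_mx B k *m M) i j = M i j + c i 0 * M k j.
  rewrite /tropical_mx mulmxDl mul1mx -mulmxA -rowE mxE; congr (_ + _).
  by rewrite mxE big_ord1 [row _ _ _ _]mxE.
have mul_E (M : 'M[int]_N) i j :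
    (M *m (tropical_mx B k)^T) i j = M i j + M i k * c j 0.
  rewrite -{1}[M]trmxK -trmx_mul mxE E_mul.
  by rewrite ![M^T _ _]mxE mulrC.
apply/matrixP => i j; rewrite mul_E !E_mul !mxE !eqxx /= ?orbT.
have [->|ik] := eqVneq i k; have [->|jk] := eqVneq j k => /=.
- by rewrite Bkk; ring.
- by rewrite Bkk; ring.
- by rewrite Bkk; ring.
- rewrite Bkk half_tropical (skewE i k Bskew) oppr_gt0; ring.
Qed.

Lemma skew_congr N (E B B' : 'M[int]_N) :
  E *m E = 1%:M -> E *m B' *m E^T = B -> B^T = - B -> B'^T = - B'.
Proof.
move=> EE EB Bskew.
have EET : E^T *m E^T = 1%:M by rewrite -trmx_mul EE trmx1.
have -> : B' = E *m B *m E^T.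
  by rewrite -EB !mulmxA EE mul1mx -mulmxA EET mulmx1.
by rewrite !trmx_mul trmxK Bskew mulNmx mulmxN !mulmxA.
Qed.

Lemma skew_mutate N (B : 'M[int]_N) k :
  B^T = - B -> (mutate_mx B k)^T = - mutate_mx B k.
Proof.
move=> Bskew; exact: skew_congr (tropical_mx_invol B k)
  (tropical_mutation k Bskew) Bskew.
Qed.

(** * Cluster mutation in logarithmic coordinates *)

Definition real_mx (R : realType) m n (B : 'M[int]_(m, n)) : 'M[R]_(m, n) :=
  map_mx (intr : int -> R) B.

Definition row_exp (R : realType) n (x : 'rV[R]_n) : 'rV[R]_n := map_mx expR x.

Definition row_ln (R : realType) n (u : 'rV[R]_n) : 'rV[R]_n :=
  map_mx (@ln R) u.

(** Let [a] and [b] be the logarithms of the two monomials of the exchange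
    relation, with positive and negative [B_kj] respectively. Then [e^a + e^b =
    e^a (1 + e^(b - a))]: the monomial [e^a] is absorbed in the linear map, and
    [b - a = (x B)_k] is the exponent left in the shear. *)
Definition log_mutation (R : realType) N (B : 'M[int]_N) (k : 'I_N)
    (x : 'rV[R]_N) : 'rV[R]_N :=
  (x - ln (1 + expR ((x *m real_mx R B) 0 k)) *: delta_mx 0 k)
  *m real_mx R (tropical_mx B k).

Lemma real_mxM (R : realType) m n p (A : 'M[int]_(m, n)) (B : 'M[int]_(n, p)) :
  real_mx R (A *m B) = real_mx R A *m real_mx R B.
Proof. exact: map_mxM. Qed.

Lemma real_mx_skew (R : realType) N (B : 'M[int]_N) :
  B^T = - B -> (real_mx R B)^T = - real_mx R B.
Proof. by move=> Bskew; rewrite /real_mx map_trmx Bskew map_mxN. Qed.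

Lemma presymplectic_congr (R : realType) N (E A A' : 'M[int]_N) :
  E \in unitmx -> E *m A' *m E^T = A ->
  presymplectic_map (real_mx R A) (real_mx R A') (fun x => x *m real_mx R E).
Proof.
move=> uE <-; apply: presymplectic_mulmx.
  have /mulmx1_unit[] : real_mx R E *m real_mx R (invmx E) = 1%:M.
    by rewrite -real_mxM mulmxV// /real_mx map_mx1.
  by [].
by rewrite !real_mxM /real_mx map_trmx.
Qed.

Lemma presymplectic_mutation (R : realType) N (B : 'M[int]_N) k :
  B^T = - B ->
  presymplectic_map (real_mx R B) (real_mx R (mutate_mx B k))
    (log_mutation B k).
Proof.
move=> Bskew.
have shearP : presymplectic_map (real_mx R B) (real_mx R B)
    (fun x => x - ln (1 + expR ((x *m real_mx R B) 0 k)) *: delta_mx 0 k).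
  apply: (@presymplectic_transvection R N _ k (fun t => ln (1 + expR t))).
  - exact: real_mx_skew.
  - exact: derivable_ln1expR.
  - apply: elementary_ln1expR; exact: elementary_map_mulmx.
apply: (presymplectic_comp shearP (G := fun y => y *m _)).
apply: presymplectic_congr; last exact: tropical_mutation.
by have [] := mulmx1_unit (tropical_mx_invol B k).
Qed.

Lemma expR_exprz (R : realType) (x : R) (z : int) :
  expR x ^ z = expR (x * z%:~R).
Proof.
case: z => n.
  by rewrite -exprnP -expRM_natr.
by rewrite NegzE -invr_expz -exprnP -expRM_natr -expRN -mulrN mulrNz.
Qed.

Lemma prod_row_exp (R : realType) N (x : 'rV[R]_N) (P : pred 'I_N)
    (b : 'I_N -> int) :
  \prod_(j < N | P j) row_exp x 0 j ^ b j
  = expR (\sum_(j < N | P j) x 0 j * (b j)%:~R).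
Proof. by rewrite expR_sum; apply: eq_bigr => j _; rewrite mxE expR_exprz. Qed.

(** The shear enters with a minus sign, which the factor [-1] on the coordinate
    [k] reverses. *)
Lemma log_mutationE (R : realType) N (B : 'M[int]_N) k (x : 'rV[R]_N) i :
  B k k = 0 ->
  log_mutation B k x 0 i =
    if i == k then
      \sum_(j < N | 0 < B k j) x 0 j * (B k j)%:~R
      + ln (1 + expR ((x *m real_mx R B) 0 k)) - x 0 k
    else x 0 i.
Proof.
move=> Bkk; rewrite /log_mutation; set L := ln _; set y := x - _.
have -> : real_mx R (tropical_mx B k) =
    1%:M + real_mx R (tropical_col B k) *m delta_mx 0 k.
  by rewrite /real_mx map_mxD map_mx1 map_mxM map_delta_mx.
rewrite mulmxDr mulmx1 mulmxA mxE [X in _ + X]mxE big_ord1.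
have yE j : y 0 j = x 0 j - L * (j == k)%:R by rewrite !mxE.
rewrite yE [delta_mx _ _ _ _]mxE/=; case: eqVneq => [->|ik]; last first.
  by rewrite !mulr0 subr0 addr0.
rewrite mxE (bigD1 k)//= [X in (_ + X) * _](_ : _ =
  \sum_(j < N | 0 < B k j) x 0 j * (B k j)%:~R).
  rewrite yE eqxx [real_mx _ _ _ _]mxE [tropical_col _ _ _ _]mxE eqxx/=.
  by ring.
rewrite big_mkcond [RHS]big_mkcond; apply: eq_bigr => j _; rewrite yE.
rewrite [real_mx _ _ _ _]mxE [tropical_col _ _ _ _]mxE.
case: eqVneq => [->|jk]; first by rewrite Bkk.
by case: ifP; rewrite ?mulr0 ?subr0.
Qed.

Lemma mutate_cluster_row_exp (R : realType) N (B : 'M[int]_N) k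
    (x : 'rV[R]_N) :
  B^T = - B ->
  mutate_cluster B (row_exp x) k = row_exp (log_mutation B k x).
Proof.
move=> Bskew; have Bkk := skew_diag k Bskew.
apply/rowP => i; rewrite mxE [RHS]mxE log_mutationE//.
case: eqP => _; last by rewrite mxE.
rewrite !prod_row_exp [row_exp _ _ _]mxE.
set a := \sum_(j | _) _; set b := \sum_(j | _) _; set t := (_ *m _) 0 k.
have -> : b = t + a.
  rewrite /a /b /t mxE big_mkcond [X in _ = _ + X]big_mkcond -big_split/=.
  apply: eq_bigr => j _; rewrite mxE.
  rewrite (skewE k j Bskew).
  by rewrite mulrNz; case: ltrgtP => [_|_|->]; rewrite ?mulr0z; ring.
rewrite expRB 2!expRD lnK ?posrE ?addr_gt0 ?expR_gt0//.
by congr (_ / _); ring.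
Qed.

Lemma mutate_seeds_row_exp (R : realType) N (s : seq 'I_N) (B : 'M[int]_N) :
  B^T = - B ->
  exists2 F : 'rV[R]_N -> 'rV[R]_N,
    presymplectic_map (real_mx R B) (real_mx R (foldl (@mutate_mx N) B s)) F
  & forall x, (foldl (@mutate_seed R N) (B, row_exp x) s).2 = row_exp (F x).
Proof.
elim: s B => [|k s IHs] B Bskew /=.
  exists (fun x => x *m real_mx R 1%:M).
    apply: presymplectic_congr; first exact: unitmx1.
    by rewrite mul1mx trmx1 mulmx1.
  by move=> x; rewrite /real_mx map_mx1 mulmx1.
have [F presF FE] := IHs (mutate_mx B k) (skew_mutate k Bskew).
exists (F \o log_mutation B k).
  exact: presymplectic_comp (presymplectic_mutation R k Bskew) presF.
by move=> x; rewrite /mutate_seed/= mutate_cluster_row_exp// FE.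
Qed.

Lemma sigma_mx_exp_orthogonal N m :
  sigma_mx N ^+ m *m (sigma_mx N ^+ m)^T = 1%:M.
Proof.
elim: m => [|m IHm]; first by rewrite expr0 trmx1 mulmx1.
rewrite exprSr trmx_mul mulmxA -[_ * _ *m _]mulmxA.
suff -> : sigma_mx N *m (sigma_mx N)^T = 1%:M by rewrite mulmx1.
apply/matrixP => i j; rewrite mxE (bigD1 (ordS i))//= big1.
  by rewrite !mxE eqxx mul1r addr0 (can_eq (@ordSK N)).
by move=> l /negPf li; rewrite !mxE li mul0r.
Qed.

Lemma iter_sigma_row_exp (R : realType) N m (x : 'rV[R]_N) :
  iter m (@sigma R N) (row_exp x)
  = row_exp (x *m real_mx R (sigma_mx N ^+ m)^T).
Proof.
elim: m => [|m IHm].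
  by rewrite expr0 trmx1 /real_mx map_mx1 mulmx1.
rewrite iterS IHm exprS trmx_mul real_mxM mulmxA.
move: (x *m _) => y; apply/rowP => i; rewrite 3!mxE; congr expR.
rewrite mxE (bigD1 (ordS i))//= big1 => [|j /negPf ji].
  by rewrite !mxE eqxx mulr1 addr0.
by rewrite !mxE ji mulr0.
Qed.

Lemma quiver_mx_skew N (Q : quiver N) : (quiver_mx Q)^T = - quiver_mx Q.
Proof. by apply/matrixP => i j; rewrite !mxE opprB. Qed.

(** As [sigma^m] is orthogonal, the congruence by its transpose is the
    conjugation in the period condition, so it carries the form of the last seed
    to that of the initial one. *)
Lemma cluster_map_row_exp (R : realType) N (Q : quiver N) m :
  period_eq Q m ->
  exists2 F : 'rV[R]_N -> 'rV[R]_N,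
    presymplectic_map (real_mx R (quiver_mx Q)) (real_mx R (quiver_mx Q)) F
  & forall x, cluster_iteration_map Q m (row_exp x) = row_exp (F x).
Proof.
move=> perQ.
have [F presF FE] :=
  mutate_seeds_row_exp R (first_nodes N m) (quiver_mx_skew Q).
pose P := sigma_mx N ^+ m.
have PPT : P *m P^T = 1%:M := sigma_mx_exp_orthogonal N m.
have [uP uPT] := mulmx1_unit PPT.
exists ((fun x => x *m real_mx R P^T) \o F); last first.
  by move=> x; rewrite /cluster_iteration_map FE iter_sigma_row_exp.
apply: presymplectic_comp presF _; apply: presymplectic_congr => //.
rewrite trmxK; have -> : P^T = invmx P by rewrite -[RHS]mulmx1 -PPT mulKmx.
exact/esym.
Qed.

(** * The exponential chart of the orthant *)

Lemma row_lnK (R : realType) n (u : 'rV[R]_n) :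
  orthant u -> row_exp (row_ln u) = u.
Proof. by move=> u0; apply/rowP => i; rewrite !mxE lnK// posrE. Qed.

Lemma row_expK (R : realType) n (x : 'rV[R]_n) : row_ln (row_exp x) = x.
Proof. by apply/rowP => i; rewrite !mxE expRK. Qed.

Lemma orthant_row_exp (R : realType) n (x : 'rV[R]_n) : orthant (row_exp x).
Proof. by move=> i; rewrite mxE expR_gt0. Qed.

Lemma elementary_row_exp (R : realType) n (U : set 'rV[R]_n) :
  elementary_map U (@row_exp R n).
Proof.
move=> i; under eq_fun do rewrite mxE.
exact/elementary_expR/elementary_coord.
Qed.

Lemma elementary_row_ln (R : realType) n :
  elementary_map (@orthant R n) (@row_ln R n).
Proof.
move=> i; under eq_fun do rewrite mxE.
apply: elementary_ln; [exact: elementary_coord|by move=> x; apply].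
Qed.

Lemma diff_row_exp (R : realType) n (x v : 'rV[R]_n) i :
  'd (@row_exp R n) x v 0 i = row_exp x 0 i * v 0 i.
Proof.
have dexp : differentiable (@row_exp R n) x.
  exact: elementary_map_differentiable (elementary_row_exp setT) I.
rewrite -deriveE// derive_row//.
have -> : (fun y : 'rV[R]_n => row_exp y 0 i) =
    expR \o (fun y : 'rV[R]_n => y 0 i).
  by apply/funext => y; rewrite mxE.
have [_ ->] := differentiable_comp1 (is_derive_expR (x 0 i))
  (differentiable_coord x 0 i).
by rewrite derive_coord mxE.
Qed.

Lemma diff_row_ln (R : realType) n (u v : 'rV[R]_n) :
  orthant u -> 'd (@row_ln R n) u v = \row_i (v 0 i / u 0 i).
Proof.
move=> u0; have dln : differentiable (@row_ln R n) u.
  exact: elementary_map_differentiable (@elementary_row_ln R n) u0.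
apply/rowP => i; rewrite [RHS]mxE -deriveE// derive_row//.
have -> : (fun y : 'rV[R]_n => row_ln y 0 i) =
    @ln R \o (fun y : 'rV[R]_n => y 0 i).
  by apply/funext => y; rewrite mxE.
have [_ ->] := differentiable_comp1 (is_derive1_ln (u0 i))
  (differentiable_coord u 0 i).
by rewrite derive_coord mulrC.
Qed.

Definition log_chart (R : realType) n p (G : 'rV[R]_n -> 'rV[R]_p) :
  'rV[R]_n -> 'rV[R]_p := @row_exp R p \o (G \o @row_ln R n).

Lemma elementary_log_chart (R : realType) n p (G : 'rV[R]_n -> 'rV[R]_p) :
  elementary_map setT G -> elementary_map (@orthant R n) (log_chart G).
Proof.
move=> eG; apply: (elementary_map_comp (V := setT)) => //.
  exact: (elementary_map_comp (V := setT) (@elementary_row_ln R n)).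
exact: elementary_row_exp.
Qed.

Lemma smooth_log_chart (R : realType) n p (G : 'rV[R]_n -> 'rV[R]_p) :
  elementary_map setT G -> smooth_map (log_chart G).
Proof.
move=> eG; split=> [x _|r]; first exact: orthant_row_exp.
apply: elementary_class_C; first exact: open_orthant.
exact: elementary_log_chart.
Qed.

(** In terms of logarithmic differentials [v_j / u_j], the differential of
    [log_chart G] is that of [G]. *)
Lemma diff_log_chart (R : realType) n p (G : 'rV[R]_n -> 'rV[R]_p) u v i :
  elementary_map setT G -> orthant u ->
  'd (log_chart G) u v 0 i =
    log_chart G u 0 i * 'd G (row_ln u) (\row_j (v 0 j / u 0 j)) 0 i.
Proof.
move=> eG u0; rewrite /log_chart.
have dln : differentiable (@row_ln R n) u.
  exact: elementary_map_differentiable (@elementary_row_ln R n) u0.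
have dG : differentiable G (row_ln u).
  exact: elementary_map_differentiable eG I.
have dexp x : differentiable (@row_exp R p) x.
  exact: elementary_map_differentiable (elementary_row_exp setT) I.
have dGln : differentiable (G \o @row_ln R n) u by exact: differentiable_comp.
have lnE := congr1 ('d G (row_ln u)) (diff_row_ln v u0).
have GlnE := etrans (diff_compE v dln dG) lnE.
have expE := congr1 ('d (@row_exp R p) (G (row_ln u))) GlnE.
have chainE := etrans (diff_compE v dGln (dexp (G (row_ln u)))) expE.
exact: etrans (congr1 (fun w : 'rV[R]_p => w 0 i) chainE) (diff_row_exp _ _ _).
Qed.

Lemma submersion_log_chart (R : realType) n p (W : 'M[R]_(n, p))
    (S : 'M[R]_(p, n)) :
  S *m W = 1%:M -> submersion (log_chart (fun x => x *m W)).
Proof.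
move=> SW; have eW := elementary_map_mulmx (@setT 'rV[R]_n) W.
split=> [|u u0 w]; first exact: smooth_log_chart.
set p' := log_chart _.
pose z : 'rV_p := \row_i (w 0 i / p' u 0 i).
exists (\row_j (u 0 j * (z *m S) 0 j)); apply/rowP => i.
rewrite diff_log_chart// -/p' diff_mulmx.
rewrite (_ : \row_j _ = z *m S); last first.
  by apply/rowP => j; rewrite !mxE mulrC mulKf// gt_eqF.
rewrite -mulmxA SW mulmx1 [z _ _]mxE mulrCA divff ?mulr1// gt_eqF//.
exact: orthant_row_exp.
Qed.

Lemma log_symplectic_formE (R : realType) k (y v w : 'rV[R]_k.*2) :
  log_symplectic_form y v w =
  symp (\row_i (v 0 i / y 0 i)) (\row_i (w 0 i / y 0 i)).
Proof. by apply: eq_bigr => i _; rewrite /wedge /dlog !mxE. Qed.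

Lemma symplectic_log_chart (R : realType) k (G : 'rV[R]_k.*2 -> 'rV[R]_k.*2) :
  elementary_map setT G ->
  (forall x v w, symp ('d G x v) ('d G x w) = symp v w) ->
  log_symplectic_map (log_chart G).
Proof.
move=> eG dG y y0 v w; rewrite /pullback !log_symplectic_formE.
have quot u : \row_i ('d (log_chart G) y u 0 i / log_chart G y 0 i)
    = 'd G (row_ln y) (\row_j (u 0 j / y 0 j)).
  apply/rowP => i; rewrite mxE diff_log_chart// mulrC mulKf// gt_eqF//.
  exact: orthant_row_exp.
by rewrite !quot dG.
Qed.

(** * Reduction of the cluster map *)

Theorem theorem2 (R : realType) (N m k : nat) (Q : quiver N)
    (hQ : periodic Q m)
    (hrank : \rank (map_mx (intr : int -> rat) (quiver_mx Q)) = k.*2)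
    (hk : (k.*2 < N)%N) :
  exists (p : 'rV[R]_N -> 'rV[R]_k.*2) (phihat : 'rV[R]_k.*2 -> 'rV[R]_k.*2),
    [/\ submersion p,
        smooth_map phihat,
        forall u : 'rV[R]_N, orthant u ->
          p (cluster_iteration_map Q m u) = phihat (p u)
      & log_symplectic_map phihat].
Proof.
have [_ perQ _] := hQ.
pose A := real_mx R (quiver_mx Q).
have Askew : A^T = - A by exact/real_mx_skew/quiver_mx_skew.
have rankA : \rank A = k.*2.
  rewrite -hrank -(mxrank_map (ratr : rat -> R)) -map_mx_comp.
  congr (\rank _).
  by apply/matrixP => i j; rewrite !mxE /= ratr_int.
have [W [S [SW formE kerE]]] := symplectic_factor Askew rankA.
have [F [eF AF dF] FE] := cluster_map_row_exp R perQ.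
pose G (y : 'rV[R]_k.*2) := F (y *m S) *m W.
have FS : elementary_map setT (fun y : 'rV[R]_k.*2 => F (y *m S)).
  exact: (elementary_map_comp (V := setT) (elementary_map_mulmx setT S)).
have eG : elementary_map setT G.
  exact: (elementary_map_comp (V := setT) FS _ (elementary_map_mulmx setT W)).
exists (log_chart (fun x => x *m W)), (log_chart G); split.
- exact: submersion_log_chart SW.
- exact: smooth_log_chart.
- move=> u u0; rewrite -{1}(row_lnK u0) FE /log_chart/= !row_expK.
  set x := row_ln u; congr row_exp; rewrite /G.
  (* x and x W S agree under W, hence under A; F transports this agreement. *)
  apply/subr0_eq; rewrite -mulmxBl; apply/kerE; rewrite mulmxBl.
  apply/eqP; rewrite subr_eq0; apply/eqP/AF/subr0_eq; rewrite -mulmxBl.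
  by apply/kerE; rewrite mulmxBl -!mulmxA SW mulmx1 subrr.
- apply: symplectic_log_chart => // y v w.
  have dFy : differentiable F (y *m S).
    exact: elementary_map_differentiable eF I.
  have dS := differentiable_mulmx S y.
  have dFS : differentiable (fun y : 'rV[R]_k.*2 => F (y *m S)) y.
    exact: elementary_map_differentiable FS I.
  have dW := differentiable_mulmx W (F (y *m S)).
  have dGE z : 'd G y z = 'd F (y *m S) (z *m S) *m W.
    apply: etrans (diff_compE z dFS dW) _.
    rewrite diff_mulmx; congr (_ *m W).
    by apply: etrans (diff_compE z dS dFy) _; rewrite diff_mulmx.
  by rewrite !dGE -formE dF formE -!mulmxA SW !mulmx1.
Qed.
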